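(* Let $\mathcal{A}$ be an ordinal randomized stable algorithm. Then $\mathrm{dist}(\mathcal{A})\ge 2$.
   Context: Setting (stable matching): there are two disjoint sets of agents, men $M=\{m_1,\dots,m_n\}$ and women $W=\{w_1,\dots,w_n\}$. Every agent $a$ has a valuation function $v_a$ assigning a non-negative real value to each agent of the opposite side; $\mathbf{v}$ denotes the profile of all valuation functions (no normalization is imposed). A preference profile $\succ$ consists of a strict ranking $\succ_a$ of the opposite side for each agent $a$. It is consistent with (induced by) $\mathbf{v}$ if $b\succ_a b'$ implies $v_a(b)\ge v_a(b')$ (ties in values are broken arbitrarily to get strict rankings). A matching $\mu$ is a perfect one-to-one matching of $M$ and $W$; $\mu(a)$ is the partner of $a$. A pair $(m,w)$ is blocking for $\mu$ if $w\succ_m\mu(m)$ and $m\succ_w\mu(w)$. $\mu$ is stable if it has no blocking pair. $\mathcal{M}_s(\succ)$ is the set of stable matchings of $\succ$. The social welfare is $\mathrm{SW}(\mu\mid\mathbf{v})=\sum_{a\in M\cup W}v_a(\mu(a))$. A randomized stable matching of $\succ$ is a probability distribution over $\mathcal{M}_s(\succ)$ (ex-post stability); $\Delta(\mathcal{M}_s(\succ))$ is the set of these, and the social welfare of a randomized matching is its expected social welfare. An ordinal randomized stable algorithm $\mathcal{A}$ is a function that, for every $n$, maps each preference profile $\succ$ (with $n$ men and $n$ women) to an element $\mathcal{A}(\succ)\in\Delta(\mathcal{M}_s(\succ))$; it does not see the values. Its distortion is $$\mathrm{dist}(\mathcal{A})=\sup_{n,\mathbf{v}}\frac{\max_{\mu\in\mathcal{M}_s(\succ_{\mathbf{v}})}\mathrm{SW}(\mu\mid\mathbf{v})}{\mathrm{SW}(\mathcal{A}(\succ_{\mathbf{v}})\mid\mathbf{v})},$$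 where the supremum is over all $n$, all valuation profiles $\mathbf{v}$ and preference profiles $\succ_{\mathbf{v}}$ consistent with $\mathbf{v}$, with the conventions $c/0=+\infty$ for $c>0$ and $0/0=1$. *)

(* Defs.v *)
From HB Require Import structures.
From mathcomp Require Import all_boot all_order all_algebra all_fingroup.
From mathcomp Require Import all_classical all_reals all_analysis.

Set Implicit Arguments.
Unset Strict Implicit.
Unset Printing Implicit Defensive.

Import Order.TTheory GRing.Theory Num.Theory.

Local Open Scope ring_scope.

(* The men are m_0, ..., m_(n-1) and the women w_0, ..., w_(n-1); both sides
   are indexed by 'I_n, and the two roles are kept apart by the field names. *)

(* A strict ranking of the opposite side: r b is the position of agent b, and
   position 0 is the most preferred one. *)
Definition ranking (n : nat) := {perm 'I_n}.

Definition prefers (n : nat) (r : ranking n) (b b' : 'I_n) : bool :=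
  (r b < r b')%N.

(* Finite functions, so that a profile is determined by its rankings. *)
Definition pref_profile (n : nat) : Type :=
  ({ffun 'I_n -> ranking n} * {ffun 'I_n -> ranking n})%type.

Definition man_pref (n : nat) (P : pref_profile n) (m : 'I_n) : ranking n :=
  P.1 m.

Definition woman_pref (n : nat) (P : pref_profile n) (w : 'I_n) : ranking n :=
  P.2 w.

Record valuation_profile (R : realType) (n : nat) := ValuationProfile {
  man_val : 'I_n -> 'I_n -> R; (* man_val m w is the value v_m(w) *)
  woman_val : 'I_n -> 'I_n -> R; (* woman_val w m is the value v_w(m) *)
  man_val_ge0 : forall m w, 0 <= man_val m w;
  woman_val_ge0 : forall w m, 0 <= woman_val w m
}.

Definition consistent (R : realType) (n : nat) (v : valuation_profile R n)
    (P : pref_profile n) : Prop :=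
  (forall m w w', prefers (man_pref P m) w w' ->
     man_val v m w' <= man_val v m w) /\
  (forall w m m', prefers (woman_pref P w) m m' ->
     woman_val v w m' <= woman_val v w m).

(* mu m is the partner of the man m; the partner of the woman w is mu^-1 w. *)
Definition matching (n : nat) := {perm 'I_n}.

Definition husband (n : nat) (mu : matching n) (w : 'I_n) : 'I_n :=
  (mu^-1)%g w.

Definition blocking (n : nat) (P : pref_profile n) (mu : matching n)
    (m w : 'I_n) : bool :=
  prefers (man_pref P m) w (mu m) && prefers (woman_pref P w) m (husband mu w).

Definition stable (n : nat) (P : pref_profile n) (mu : matching n) : bool :=
  [forall m, forall w, ~~ blocking P mu m w].

Definition SW (R : realType) (n : nat) (v : valuation_profile R n)
    (mu : matching n) : R :=
  \sum_(m < n) man_val v m (mu m) + \sum_(w < n) woman_val v w (husband mu w).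

(* A probability mass function on matchings, supported on the stable ones. *)
Record rand_stable_matching (R : realType) (n : nat) (P : pref_profile n) :=
  RandStableMatching {
    prob :> matching n -> R;
    prob_ge0 : forall mu, 0 <= prob mu;
    prob_sum1 : \sum_(mu : matching n) prob mu = 1;
    prob_stable : forall mu, ~~ stable P mu -> prob mu = 0
  }.

Definition expected_SW (R : realType) (n : nat) (P : pref_profile n)
    (v : valuation_profile R n) (p : rand_stable_matching R P) : R :=
  \sum_(mu : matching n) p mu * SW v mu.

(* The default value 0 is harmless: welfare is nonnegative and stable matchings
   always exist. *)
Definition max_stable_SW (R : realType) (n : nat) (P : pref_profile n)
    (v : valuation_profile R n) : R :=
  \big[Num.max/0]_(mu : matching n | stable P mu) SW v mu.

Definition ordinal_stable_algorithm (R : realType) : Type :=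
  forall (n : nat) (P : pref_profile n), rand_stable_matching R P.

(* c / d for c, d >= 0, with c / 0 = +oo for c > 0 and 0 / 0 = 1. *)
Definition welfare_ratio (R : realType) (c d : R) : \bar R :=
  if d == 0 then (if c == 0 then 1%:E else +oo%E) else (c / d)%:E.

(* The empty market n = 0 only contributes the ratio 0 / 0 = 1, which any market
   with all values zero contributes as well. *)
Definition distortion (R : realType) (A : ordinal_stable_algorithm R) : \bar R :=
  ereal_sup [set x : \bar R |
    exists (n : nat) (v : valuation_profile R n) (P : pref_profile n),
      consistent v P /\
      x = welfare_ratio (max_stable_SW P v) (expected_SW v (A n P))]%classic.

(* Main.v *)
Require Import Defs.
From mathcomp Require Import all_boot all_order all_algebra.
From mathcomp Require Import all_classical all_reals all_analysis.
From mathcomp Require Import all_fingroup lra.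

(** In the two-by-two market in which every man's favourite woman ranks him
    last, the man-optimal and the woman-optimal matching are the only two
    matchings and both are stable. An ordinal algorithm gives one of them
    probability at most 1/2; values that are 1 exactly for the pairs of that
    matching, on the side which it favours, are consistent with the rankings
    and make all welfare come from it. *)

Set Implicit Arguments.
Unset Strict Implicit.
Unset Printing Implicit Defensive.

Import Order.TTheory GRing.Theory Num.Theory.

Local Open Scope ring_scope.

Lemma welfare_ratio_ge2 (R : realType) (c d : R) :
  0 < c -> 0 <= d -> 2 * d <= c -> (2%:E <= welfare_ratio c d)%E.
Proof.
move=> c_gt0 d_ge0 dc; rewrite /welfare_ratio.
(* An algorithm that never picks the best matching may have welfare [0]; the ratio is then [+oo]
   because [c] is positive. *)
have [_|d_neq0] := eqVneq d 0; first by rewrite gt_eqF// leey.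
by rewrite lee_fin ler_pdivlMr// lt_def d_neq0.
Qed.

Lemma SW_ge0 (R : realType) n (v : valuation_profile R n) (mu : matching n) :
  0 <= SW v mu.
Proof.
by rewrite addr_ge0 ?sumr_ge0// => i _; rewrite ?man_val_ge0 ?woman_val_ge0.
Qed.

(** Only [mu] contributes to the expected welfare, which is therefore at most half of [SW v mu],
    while the stable optimum is at least [SW v mu]. *)
Lemma distortion_ge2 (R : realType) (A : ordinal_stable_algorithm R) n
    (v : valuation_profile R n) (P : pref_profile n) (mu : matching n) :
  consistent v P -> stable P mu -> 0 < SW v mu ->
  (forall nu, nu != mu -> SW v nu = 0) ->
  A n P mu <= 2^-1 -> (2%:E <= distortion A)%E.
Proof.
move=> vP mu_stable mu_gt0 others0 p_le.
have mu_le : SW v mu <= max_stable_SW P v by exact: le_bigmax_cond.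
apply: le_trans (ereal_sup_ubound _); last by exists n, v, P; split.
apply: welfare_ratio_ge2; first exact: lt_le_trans mu_le.
- by apply: sumr_ge0 => nu _; rewrite mulr_ge0 ?prob_ge0 ?SW_ge0.
- rewrite /expected_SW (bigD1 mu)//= big1 ?addr0; last first.
    by move=> nu /others0 ->; rewrite mulr0.
  by apply: le_trans mu_le; nra.
Qed.

Lemma perm_ord2P (s : {perm 'I_2}) : s = 1%g \/ s = tperm ord0 ord_max.
Proof.
have ord2 (i : 'I_2) : i = ord0 \/ i = ord_max.
  by case: i => -[|[|//]] i_lt2; [left|right]; apply: val_inj.
have s_neq : s ord_max != s ord0 by rewrite (inj_eq perm_inj).
case: (ord2 (s ord0)) (ord2 (s ord_max)) s_neq => s0 [] s1;
  rewrite s0 s1 ?eqxx// => _; [left|right]; apply/permP => i;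
  by case: (ord2 i) => ->; rewrite ?perm1 ?tpermL ?tpermR.
Qed.

(* Man m ranks woman m first, and woman w ranks man w last. *)
Definition opposed_profile : pref_profile 2 :=
  ([ffun m => tperm ord0 m], [ffun w => tperm ord_max w]).

Definition men_favoured (R : realType) : valuation_profile R 2 :=
  @ValuationProfile R 2 (fun m w => (w == m)%:R) (fun _ _ => 0)
    (fun _ _ => ler0n _ _) (fun _ _ => lexx _).

(** Woman [w] ranks man [w] last, so in a market of size two [m != w] singles out her favourite. *)
Definition women_favoured (R : realType) : valuation_profile R 2 :=
  @ValuationProfile R 2 (fun _ _ => 0) (fun w m => (m != w)%:R)
    (fun _ _ => lexx _) (fun _ _ => ler0n _ _).

Lemma men_favoured_consistent (R : realType) :
  consistent (men_favoured R) opposed_profile.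
Proof.
split=> [m w w'|//]; rewrite /prefers /man_pref ffunE /=.
(* Only [w' = m] has a positive value, and nobody precedes it, since it sits at position 0. *)
have [->|_ _] := eqVneq w' m; last exact: ler0n.
by rewrite tpermR ltn0.
Qed.

Lemma women_favoured_consistent (R : realType) :
  consistent (women_favoured R) opposed_profile.
Proof.
split=> [//|w m m']; rewrite /prefers /woman_pref ffunE /=.
have [->|_ _] := eqVneq m w; last by rewrite ler_nat leq_b1.
by rewrite tpermR ltnNge -ltnS ltn_ord.
Qed.

(** Every man gets his first choice, so no man takes part in a blocking pair. *)
Lemma man_optimal_stable : stable opposed_profile 1%g.
Proof.
apply/forallP => m; apply/forallP => w.
by rewrite /blocking /prefers /man_pref ffunE perm1 tpermR ltn0.
Qed.

Lemma woman_optimal_stable :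
  stable opposed_profile (tperm ord0 ord_max : matching 2).
Proof.
apply/forallP => m; apply/forallP => w.
rewrite /blocking /prefers /woman_pref ffunE /husband tpermV negb_and.
apply/orP; right; rewrite -leqNgt.
(* For either woman, her husband under the swap has position 0 in her ranking, so no man improves on
   him. *)
case: w => -[|[|//]] w_lt2.
  rewrite (_ : Ordinal _ = ord0) ?tpermL//; exact: val_inj.
rewrite (_ : Ordinal _ = ord_max) ?tpermR ?tperm1 ?perm1//; exact: val_inj.
Qed.

Theorem theorem3p3 (R : realType) (A : ordinal_stable_algorithm R) :
  (2%:E <= distortion A)%E.
Proof.
pose swap : matching 2 := tperm ord0 ord_max.
have swap_neq1 : swap != 1%g.
  by apply/eqP => /permP/(_ ord0); rewrite tpermL perm1.
have prob_sum : A 2 opposed_profile 1%g + A 2 opposed_profile swap = 1.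
  rewrite -(prob_sum1 (A 2 opposed_profile)) (bigD1 1%g)//= (bigD1 swap)//=.
  rewrite big1 ?addr0// => nu /andP[].
  by case: (perm_ord2P nu) => ->; rewrite ?eqxx.
(* The values may be chosen after the probabilities are known: both valuations induce the same
   rankings, which are all that [A] sees. *)
have [p_le|p_gt] := leP (A 2 opposed_profile 1%g) 2^-1.
- apply: (distortion_ge2 (men_favoured_consistent R) man_optimal_stable _ _
    p_le).
    by rewrite /SW !big_ord_recl !big_ord0 /= !perm1 !eqxx /=; lra.
  move=> nu; case: (perm_ord2P nu) => ->; rewrite ?eqxx// => _.
  rewrite /SW !big_ord_recl !big_ord0 /= tpermL.
  by rewrite (_ : lift _ _ = ord_max) ?tpermR ?addr0//; exact: val_inj.
- have p_le : A 2 opposed_profile swap <= 2^-1 by lra.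
  apply: (distortion_ge2 (women_favoured_consistent R) woman_optimal_stable
    _ _ p_le).
    rewrite /SW !big_ord_recl !big_ord0 /= /husband tpermV tpermL.
    rewrite (_ : lift _ _ = ord_max) ?tpermR /=; last exact: val_inj.
    lra.
  move=> nu; case: (perm_ord2P nu) => ->; rewrite ?eqxx// => _.
  by rewrite /SW !big_ord_recl !big_ord0 /= /husband invg1 !perm1 !eqxx !addr0.
Qed.
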